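(* There exist an absolute constant $c\ge 1$ and a combinatorial algorithm which, given any instance $G=(V,E)$ of unweighted, complete correlation clustering on $|V|=n$ vertices, returns a single clustering $\mathcal{C}$ of $V$ such that, simultaneously for every $p\in\mathbb{R}_{\ge 1}\cup\{\infty\}$, $\lVert y_{\mathcal{C}}\rVert_p \le c\cdot \mathsf{OPT}(p)$. The running time of the algorithm is $O(n^\omega)$.
   Context: An instance of unweighted, complete correlation clustering is a complete graph $G=(V,E)$ on $n$ vertices in which every edge is labeled positive ($+$) or negative ($-$); $E^+$ and $E^-$ denote the positive and negative edges. A clustering $\mathcal{C}$ is a partition of $V$ into clusters (the number of clusters is not prescribed); $C(u)$ denotes the cluster containing $u$. A positive edge $(u,v)$ is a disagreement w.r.t. $\mathcal{C}$ if $u,v$ lie in different clusters; a negative edge $(u,v)$ is a disagreement if $u,v$ lie in the same cluster. The disagreement vector $y_{\mathcal{C}}\in\mathbb{Z}_{\ge0}^V$ has $y_{\mathcal{C}}(u)$ equal to the number of disagreements incident to $u$. For $p\in\mathbb{R}_{\ge1}\cup\{\infty\}$, $\mathsf{OPT}(p)=\min_{\mathcal{C}}\lVert y_{\mathcal{C}}\rVert_p$, the minimum over all clusterings of $V$. $O(n^\omega)$ denotes the time to multiply two $n\times n$ matrices. *)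

(* Defs.v *)
From HB Require Import structures.
From mathcomp Require Import all_boot all_order all_algebra.
From mathcomp Require Import reals constructive_ereal topology normedtype landau exp.

Set Implicit Arguments.
Unset Strict Implicit.
Unset Printing Implicit Defensive.

Import Order.TTheory GRing.Theory Num.Theory.
Import numFieldNormedType.Exports.

Local Open Scope ring_scope.

(* An edge of the complete graph on V is a pair u != v; cc_pos is E^+, and the
   remaining edges form E^-. *)
Record instance (V : finType) := Instance {
  cc_pos : rel V;
  cc_pos_sym : symmetric cc_pos;
  cc_pos_irr : irreflexive cc_pos }.

Definition cc_neg (V : finType) (G : instance V) : rel V :=
  fun u v => (u != v) && ~~ cc_pos G u v.

Definition clustering (V : finType) (C : {set {set V}}) : bool :=
  partition C [set: V].

Definition disagreement (V : finType) (G : instance V) (C : {set {set V}})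
    : rel V :=
  fun u v => (cc_pos G u v && (pblock C u != pblock C v)) ||
             (cc_neg G u v && (pblock C u == pblock C v)).

Definition disagreements (V : finType) (G : instance V) (C : {set {set V}})
    (u : V) : nat :=
  #|[set v | disagreement G C u v]|.

(* Only meant for 1 <= p: every p that is not a real number is read as +oo. *)
Definition lp_norm (R : realType) (V : finType) (p : \bar R) (x : V -> R) : R :=
  if p is r%:E then (\sum_u `|x u| `^ r) `^ r^-1
  else \big[Num.max/0]_u `|x u|.

Definition cc_cost (R : realType) (V : finType) (G : instance V) (p : \bar R)
    (C : {set {set V}}) : R :=
  lp_norm p (fun u => (disagreements G C u)%:R).

(* The minimum of the cost over all clusterings of V: the partition of V into
   singletons only serves as a witness that the range is nonempty. *)
Definition OPT (R : realType) (V : finType) (G : instance V) (p : \bar R) : R :=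
  cc_cost G p
    [arg min_(C < preim_partition id [set: V] | clustering C) cc_cost G p C]%O.

(* Programs act on integer registers and on integer arrays, both named by
   natural numbers.  Every word occurring in a run has absolute value at most
   W (a signed word of about log2 W bits); a run that leaves this range, or
   uses a negative address, is stuck.  Hence a run with W polynomial in the
   input size uses words of O(log n) bits, and unit-cost arithmetic cannot be
   abused by packing a whole matrix in one word. *)

Inductive binop := Add | Sub | Mul | Div | Lt | Eq.

Inductive expr :=
  | Const of int
  | Reg of nat
  | Read of nat & expr
  | Bin of binop & expr & expr.

Inductive cmd :=
  | Skip
  | Assign of nat & expr
  | Write of nat & expr & expr
  | Seq of cmd & cmd
  | If of expr & cmd & cmd
  | While of expr & cmd.

Record store := MkStore { regs : nat -> int; arrs : nat -> nat -> int }.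

Definition upd (A : Type) (f : nat -> A) (x : nat) (v : A) : nat -> A :=
  fun y => if y == x then v else f y.

Definition set_reg (s : store) (x : nat) (z : int) : store :=
  MkStore (upd (regs s) x z) (arrs s).

Definition set_cell (s : store) (a i : nat) (z : int) : store :=
  MkStore (regs s) (upd (arrs s) a (upd (arrs s a) i z)).

Definition word (W : nat) (z : int) : option int :=
  if (`|z| <= W)%N then Some z else None.

Definition eval_binop (o : binop) (x y : int) : int :=
  match o with
  | Add => x + y
  | Sub => x - y
  | Mul => x * y
  | Div => (x %/ y)%Z
  | Lt => (nat_of_bool (x < y))%:Z
  | Eq => (nat_of_bool (x == y))%:Z
  end.

Fixpoint eval_expr (W : nat) (s : store) (e : expr) : option int :=
  match e with
  | Const z => word W z
  | Reg x => word W (regs s x)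
  | Read a e1 => if eval_expr W s e1 is Some (Posz i) then word W (arrs s a i)
                 else None
  | Bin o e1 e2 =>
      if (eval_expr W s e1, eval_expr W s e2) is (Some x, Some y)
      then word W (eval_binop o x y) else None
  end.

Fixpoint expr_cost (e : expr) : nat :=
  match e with
  | Const _ | Reg _ => 1
  | Read _ e1 => (expr_cost e1).+1
  | Bin _ e1 e2 => (expr_cost e1 + expr_cost e2).+1
  end.

(* exec W c s t s' : with word bound W, running c from s halts in s' after
   exactly t elementary steps. *)
Inductive exec (W : nat) : cmd -> store -> nat -> store -> Prop :=
  | ExecSkip s : exec W Skip s 1 s
  | ExecAssign x e z s of eval_expr W s e = Some z :
      exec W (Assign x e) s (expr_cost e).+1 (set_reg s x z)
  | ExecWrite a e1 e2 (i : nat) z s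
      of eval_expr W s e1 = Some (Posz i) & eval_expr W s e2 = Some z :
      exec W (Write a e1 e2) s (expr_cost e1 + expr_cost e2).+1
        (set_cell s a i z)
  | ExecSeq c1 c2 s1 s2 s3 t1 t2
      of exec W c1 s1 t1 s2 & exec W c2 s2 t2 s3 :
      exec W (Seq c1 c2) s1 (t1 + t2) s3
  | ExecIf e c1 c2 z s s' t
      of eval_expr W s e = Some z & exec W (if z != 0 then c1 else c2) s t s' :
      exec W (If e c1 c2) s ((expr_cost e).+1 + t) s'
  | ExecWhileEnd e c s of eval_expr W s e = Some 0 :
      exec W (While e c) s (expr_cost e).+1 s
  | ExecWhileStep e c z s1 s2 s3 t1 t2
      of eval_expr W s1 e = Some z & z != 0 & exec W c s1 t1 s2
      & exec W (While e c) s2 t2 s3 :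
      exec W (While e c) s1 ((expr_cost e).+1 + t1 + t2) s3.

Definition halts_within (W : nat) (c : cmd) (s : store) (t : nat)
    (Q : store -> Prop) : Prop :=
  exists t' s', [/\ exec W c s t' s', (t' <= t)%N & Q s'].

(* Row-major order, padded with zeros. *)
Definition mx_array (n : nat) (A : 'M[int]_n) (m : nat) : int :=
  if (insub (m %/ n)%N, insub (m %% n)%N) is (Some i, Some j) then A i j else 0.

(* Register 0 holds the dimension, arrays 0 and 1 the arguments; everything
   else is zero. *)
Definition init_store (n : nat) (A B : 'M[int]_n) : store :=
  MkStore (upd (fun=> 0) 0 n%:Z)
          (upd (upd (fun=> fun=> 0) 0 (mx_array A)) 1 (mx_array B)).

(* M multiplies any two n x n integer matrices with polynomially bounded
   entries in at most T n steps, on words of O(log n) bits; the product is left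
   in array 2. *)
Definition multiplies_matrices (M : cmd) (T : nat -> nat) : Prop :=
  forall d : nat, exists k : nat, forall (n : nat) (A B : 'M[int]_n),
    (forall i j, `|A i j| <= (n + 2) ^ d)%N ->
    (forall i j, `|B i j| <= (n + 2) ^ d)%N ->
    halts_within ((n + 2) ^ k) M (init_store A B) (T n)
      (fun s => forall i j : 'I_n, arrs s 2 (i * n + j)%N = (A *m B) i j).

Definition cc_matrix (n : nat) (G : instance 'I_n) : 'M[int]_n :=
  \matrix_(u, v) (nat_of_bool (cc_pos G u v))%:Z.

Definition cc_store (n : nat) (G : instance 'I_n) : store :=
  init_store (cc_matrix G) 0.

(* Array 2 holds cluster names: u and v are in the same cluster iff their names
   agree. *)
Definition cc_output (n : nat) (s : store) : {set {set 'I_n}} :=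
  preim_partition (fun u : 'I_n => arrs s 2 u) [set: 'I_n].

(* Main.v *)
(* Let N(u) be the closed positive neighbourhood of u.  A positive neighbour v of
   u is "far" when N(u) and N(v) differ by a constant fraction; u is light when a
   constant fraction of N(u) is far from u.  Light vertices become singletons,
   and two heavy vertices are joined when their neighbourhoods overlap by a
   constant fraction.  Joining is transitive, because for heavy vertices a
   constant overlap forces a much larger one (through a common neighbour close
   to both).  All of this is read off from the square of the closed adjacency
   matrix in O(n^2) further steps, and O(n^2) = O(T n) since a multiplication
   program must write n^2 nonzero entries.

   For the approximation, let y be the disagreement vector of the output and z
   that of any clustering.  If u, v are far and clustered together by z, or
   joined and separated by z, then z u + z v is at least a constant times
   deg u + deg v.  Charging each disagreement of the output in this way yields
   y u <= \sum_v a u v * z v for a nonnegative matrix a whose row and column sums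
   are bounded by a constant, and such a matrix (by convexity of the power
   function) has bounded operator norm on every lp simultaneously. *)
Require Import Defs.
From mathcomp Require Import all_boot all_order all_algebra.
From mathcomp Require Import reals constructive_ereal filter topology normedtype landau exp.
From mathcomp Require Import ring lra zify.
Import Order.TTheory GRing.Theory Num.Theory.
Import numFieldNormedType.Exports.
Local Open Scope classical_set_scope.
Local Open Scope ring_scope.

Set Implicit Arguments.
Unset Strict Implicit.
Unset Printing Implicit Defensive.

(** * Domination by matrices with bounded row and column sums *)

Section Domination.
Variables (R : realFieldType) (V : finType).
Implicit Types (c k : R) (x y z : V -> R).

(** Row sums bound the operator norm on l_infinity and column sums the one on l_1; Schur's test then
    covers every lp norm in between. *)
Definition dominated c x y :=
  exists a : V -> V -> R,
    [/\ forall u v, 0 <= a u v, forall u, \sum_v a u v <= c,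
        forall v, \sum_u a u v <= c & forall u, x u <= \sum_v a u v * y v].

Lemma dominated_refl x : dominated 1 x x.
Proof.
exists (fun u v => (u == v)%:R); split=> [u v|u|v|u]; first exact: ler0n.
- by rewrite (bigD1 u) //= eqxx big1 ?addr0 // => v /negPf; rewrite eq_sym => ->.
- by rewrite (bigD1 v) //= eqxx big1 ?addr0 // => u /negPf ->.
- rewrite (bigD1 u) //= eqxx mul1r big1 ?addr0 // => v /negPf.
  by rewrite eq_sym => ->; rewrite mul0r.
Qed.

Lemma dominated_le c x x' y :
  (forall u, x' u <= x u) -> dominated c x y -> dominated c x' y.
Proof.
by move=> le_x [a [a0 ar ac ax]]; exists a; split=> // u; apply: le_trans (ax u).
Qed.

Lemma dominated_add c1 c2 x1 x2 y : dominated c1 x1 y -> dominated c2 x2 y ->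
  dominated (c1 + c2) (fun u => x1 u + x2 u) y.
Proof.
move=> [a [a0 ar ac ax]] [b [b0 br bc bx]].
exists (fun u v => a u v + b u v); split=> [u v|u|v|u].
- exact: addr_ge0.
- by rewrite big_split lerD.
- by rewrite big_split lerD.
- under eq_bigr do rewrite mulrDl.
  by rewrite big_split lerD.
Qed.

Lemma dominated_scale c k x y : 0 <= k -> dominated c x y ->
  dominated (k * c) (fun u => k * x u) y.
Proof.
move=> k0 [a [a0 ar ac ax]]; exists (fun u v => k * a u v); split=> [u v|u|v|u].
- exact: mulr_ge0.
- by rewrite -mulr_sumr ler_wpM2l.
- by rewrite -mulr_sumr ler_wpM2l.
- under eq_bigr do rewrite -mulrA.
  by rewrite -mulr_sumr ler_wpM2l.
Qed.

Lemma dominated_trans c1 c2 x y z : 0 <= c1 -> 0 <= c2 ->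
  dominated c1 x y -> dominated c2 y z -> dominated (c1 * c2) x z.
Proof.
move=> c10 c20 [a [a0 ar ac ax]] [b [b0 br bc bx]].
exists (fun u w => \sum_v a u v * b v w); split=> [u v|u|v|u].
- by apply: sumr_ge0 => w _; apply: mulr_ge0.
- rewrite exchange_big /= (@le_trans _ _ (\sum_v a u v * c2)) //.
    by apply: ler_sum => v _; rewrite -mulr_sumr ler_wpM2l.
  by rewrite -mulr_suml ler_wpM2r.
- rewrite exchange_big /= (@le_trans _ _ (\sum_w c1 * b w v)) //.
    by apply: ler_sum => w _; rewrite -mulr_suml ler_wpM2r.
  by rewrite -mulr_sumr ler_wpM2l.
- apply: (le_trans (ax u)); under [leRHS]eq_bigr do rewrite mulr_suml.
  rewrite exchange_big /=; apply: ler_sum => v _.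
  under eq_bigr do rewrite -mulrA.
  by rewrite -mulr_sumr ler_wpM2l.
Qed.

End Domination.

(** * Schur's test for the lp norms *)

Section Norms.
Variables (R : realType) (V : finType).

(* Young's inequality for the exponents [r / (r - 1)] and [r]. *)
Lemma powR_tangent (r s t : R) : 1 <= r -> 0 <= s -> 0 <= t ->
  r * (s `^ (r - 1) * t) <= (r - 1) * s `^ r + t `^ r.
Proof.
rewrite le_eqVlt => /predU1P[<- s0 t0|r1 s0 t0].
  by rewrite subrr powRr0 !mul1r mul0r add0r powRr1.
have r0 : 0 < r by apply: lt_trans r1.
have r10 : 0 < r - 1 by rewrite subr_gt0.
have q0 : 0 < r / (r - 1) by rewrite divr_gt0.
have := @conjugate_powR R (s `^ (r - 1)) t (r / (r - 1)) r
  (powR_ge0 _ _) t0 q0 r0.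
have -> : (r / (r - 1))^-1 + r^-1 = 1 by field; rewrite !gt_eqF.
move=> /(_ erefl); rewrite -powRrM.
have -> : (r - 1) * (r / (r - 1)) = r by field; rewrite gt_eqF.
move=> H; have := ler_wpM2l (ltW r0) H; congr (_ <= _).
by field; rewrite !gt_eqF.
Qed.

(* Sum the tangent inequality at the point [m / c], where [m] is the weighted sum. *)
Lemma powR_sum_le (r c : R) (a y : V -> R) : 1 <= r -> 0 < c ->
  (forall v, 0 <= a v) -> (forall v, 0 <= y v) -> \sum_v a v <= c ->
  (\sum_v a v * y v) `^ r <= c `^ (r - 1) * \sum_v a v * y v `^ r.
Proof.
move=> r1 c0 a0 y0 ac; set m := \sum_v _ * _.
have m0 : 0 <= m by apply: sumr_ge0 => v _; apply: mulr_ge0.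
have s0 : 0 <= m / c by apply: divr_ge0 => //; apply: ltW.
have r0 : 0 < r by apply: lt_le_trans r1.
have H : r * ((m / c) `^ (r - 1) * m) <=
         (r - 1) * (m / c) `^ r * c + \sum_v a v * y v `^ r.
  apply: (@le_trans _ _ (\sum_v a v * ((r - 1) * (m / c) `^ r + y v `^ r))).
    rewrite {2}/m mulrA mulr_sumr; apply: ler_sum => v _.
    by rewrite mulrCA -mulrA ler_wpM2l // powR_tangent.
  under eq_bigr do rewrite mulrDr.
  rewrite big_split /= lerD2r -mulr_suml mulrC ler_wpM2l //.
  by rewrite mulr_ge0 ?powR_ge0 // subr_ge0.
have E : (m / c) `^ (r - 1) * m = (m / c) `^ r * c.
  by rewrite -(mulr_powRB1 s0 r0) mulrAC divfK ?gt_eqF // mulrC.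
move: H; rewrite E -mulrA -{1}(addrNK 1 r) mulrDl mul1r lerD2l => H.
have := ler_wpM2l (powR_ge0 c (r - 1)) H; congr (_ <= _).
rewrite mulrCA [_ * c]mulrC mulr_powRB1 ?ltW // -powRM ?(ltW c0) //.
by rewrite divfK // gt_eqF.
Qed.

Lemma dominated_lp_norm (c : R) (p : \bar R) (x y : V -> R) :
  0 < c -> (1 <= p)%E -> (forall u, 0 <= x u) -> (forall u, 0 <= y u) ->
  dominated c x y -> lp_norm p x <= c * lp_norm p y.
Proof.
move=> c0 p1 x0 y0 [a [a0 ar ac ax]].
have Ex u : `|x u| = x u by rewrite ger0_norm.
have Ey u : `|y u| = y u by rewrite ger0_norm.
case: p p1 => [r||] //=; last first.
  move=> _; rewrite /lp_norm.
  set m := \big[Num.max/0]_u `|y u|.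
  have m0 : 0 <= m by rewrite /m; elim/big_rec: _ => // i z _ h; rewrite le_max h orbT.
  have ym v : y v <= m by rewrite /m (bigD1 v) //= le_max Ey lexx.
  elim/big_ind: _ => [|s t sm tm|u _]; first by rewrite mulr_ge0 // ltW.
    by rewrite ge_max sm tm.
  rewrite Ex (le_trans (ax u)) // (@le_trans _ _ (\sum_v a u v * m)) //.
    by apply: ler_sum => v _; rewrite ler_wpM2l.
  by rewrite -mulr_suml ler_wpM2r.
rewrite lee_fin => r1; rewrite /lp_norm.
have r0 : 0 < r by apply: lt_le_trans r1.
have S0 (z : V -> R) : 0 <= \sum_u z u `^ r by apply: sumr_ge0 => u _; apply: powR_ge0.
under eq_bigr do rewrite Ex.
under [X in _ <= c * X `^ _]eq_bigr do rewrite Ey.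
(* With [c] written as an [r]-th root, the claim compares power sums: row sums supply the power r -
   1 of [c] and, after exchanging sums, column sums supply the last factor [c]. *)
have -> : c = (c `^ r) `^ r^-1.
  by rewrite -powRrM divff ?gt_eqF // powRr1 // ltW.
rewrite -powRM ?powR_ge0 //.
apply: ge0_ler_powR; rewrite ?invr_ge0 ?nnegrE ?mulr_ge0 ?powR_ge0 ?S0 ?(ltW r0) //.
apply: (@le_trans _ _ (\sum_u c `^ (r - 1) * \sum_v a u v * y v `^ r)).
  apply: ler_sum => u _; apply: le_trans (powR_sum_le r1 c0 (a0 u) y0 (ar u)).
  apply: ge0_ler_powR; rewrite ?nnegrE ?(ltW r0) //.
  by apply: sumr_ge0 => v _; apply: mulr_ge0.
rewrite -mulr_sumr exchange_big /= -(mulr_powRB1 (ltW c0) r0) [c * _]mulrC -mulrA.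
rewrite ler_wpM2l ?powR_ge0 // mulr_sumr.
by apply: ler_sum => v _; rewrite -mulr_suml ler_wpM2r ?powR_ge0.
Qed.

End Norms.

(** * The clustering and its disagreements *)

Section Clusters.
Local Open Scope nat_scope.
Variables (V : finType) (G : instance V).

Definition nbhd (u : V) : {set V} := [set v | (u == v) || cc_pos G u v].
Definition codeg (u v : V) : nat := #|nbhd u :&: nbhd v|.
(** A diagonal case of [codeg], since the program reads degrees off the diagonal of the squared
    matrix. *)
Definition deg (u : V) : nat := codeg u u.
(** Because [dist u v + 2 * codeg u v = deg u + deg v], this says that [dist u v] exceeds 1/11 of
    [deg u + deg v]. *)
Definition far (u v : V) : bool := 11 * codeg u v < 5 * (deg u + deg v).
Definition far_nbhd (u : V) : {set V} := [set v in nbhd u | far u v].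
Definition bad (u : V) : nat := #|far_nbhd u|.
Definition light (u : V) : bool := deg u < 5 * bad u.
Definition alike (u v : V) : bool :=
  [&& ~~ light u, ~~ light v & deg u + deg v <= 4 * codeg u v].
Definition joined (u v : V) : bool := (u == v) || alike u v.
Definition dist (u v : V) : nat := #|(nbhd u :\: nbhd v) :|: (nbhd v :\: nbhd u)|.

Lemma degE u : deg u = #|nbhd u|.
Proof. by rewrite /deg /codeg setIid. Qed.

Lemma mem_nbhdC u v : (u \in nbhd v) = (v \in nbhd u).
Proof. by rewrite !inE eq_sym (cc_pos_sym G). Qed.

Lemma in_far_nbhd u v : (v \in far_nbhd u) = (v \in nbhd u) && far u v.
Proof. by rewrite [LHS]in_set. Qed.

Lemma mem_nbhd u : u \in nbhd u.
Proof. by rewrite inE eqxx. Qed.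

Lemma deg_gt0 u : 0 < deg u.
Proof. by rewrite degE; apply/card_gt0P; exists u; apply: mem_nbhd. Qed.

Lemma codegC u v : codeg u v = codeg v u.
Proof. by rewrite /codeg setIC. Qed.

Lemma farC u v : far u v = far v u.
Proof. by rewrite /far codegC addnC. Qed.

Lemma alikeC u v : alike u v = alike v u.
Proof. by rewrite /alike codegC addnC andbCA. Qed.

Lemma dist_codeg u v : dist u v + 2 * codeg u v = deg u + deg v.
Proof.
rewrite /dist !degE cardsU.
have -> : (nbhd u :\: nbhd v) :&: (nbhd v :\: nbhd u) = set0.
  apply/setP=> x; rewrite in_setI !in_setD in_set0.
  by case: (x \in nbhd u); case: (x \in nbhd v).
rewrite cards0 subn0 -(cardsID (nbhd v) (nbhd u)) -(cardsID (nbhd u) (nbhd v)).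
by rewrite [nbhd v :&: nbhd u]setIC -/(codeg u v); lia.
Qed.

Lemma dist_triangle u v w : dist u w <= dist u v + dist v w.
Proof.
rewrite /dist -cardsUI; apply: leq_trans (leq_addr _ _).
apply: subset_leq_card; apply/subsetP => x; rewrite !in_setU !in_setD.
by case: (x \in nbhd u); case: (x \in nbhd v); case: (x \in nbhd w).
Qed.

Lemma deg_dist u v : deg u <= deg v + dist u v.
Proof.
have := dist_codeg u v; have : codeg u v <= deg v.
  by rewrite degE subset_leq_card // subsetIr.
lia.
Qed.

Lemma distC u v : dist u v = dist v u.
Proof. by rewrite /dist setUC. Qed.

(* The gap: heaviness upgrades constant overlap to near-total overlap, via a
   common neighbour close to both; this makes [joined] transitive. *)
Lemma alike_gap u v : alike u v -> 2 * (deg u + deg v) <= 5 * codeg u v.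
Proof.
rewrite /alike /light -!leqNgt => /and3P[bu bv uv].
have [x /setIP[xu xv] /andP[nu nv]] : exists2 x, x \in nbhd u :&: nbhd v &
    ~~ far u x && ~~ far v x.
  apply/exists_inP; apply: contraT; rewrite negb_exists_in => /forall_inP H.
  (* If every common neighbour is far from [u] or [v], heaviness bounds [codeg u v] by a fifth of
     [deg u + deg v], while alikeness requires a quarter. *)
  have : codeg u v <= bad u + bad v.
    rewrite /codeg /bad -cardsUI; apply: leq_trans (leq_addr _ _).
    apply/subset_leq_card/subsetP => x xuv; have := H _ xuv.
    move: xuv; rewrite in_setI => /andP[xu xv].
    by rewrite in_setU !in_far_nbhd xu xv /=; case: far; case: far.
  have := deg_gt0 u; lia.
move: nu nv; rewrite /far -!leqNgt => nu nv.
(* Let D be [deg u + deg v]. Closeness makes [deg x] at most 6/5 of each degree, so [dist u v] is at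
   most (D + 6/5 D) / 11 = D / 5, which leaves [codeg u v] at least 2/5 of D. *)
have := dist_triangle u x v; rewrite (distC x v).
have := dist_codeg u x; have := dist_codeg v x; have := dist_codeg u v.
have := deg_dist x u; have := deg_dist x v; rewrite !(distC x); lia.
Qed.

(** By the gap, both distances are at most a fifth of their degree sums, and [deg v] is at most 3/2
    of [deg u] and of [deg w]. The triangle inequality then bounds [dist u w] by half of
    [deg u + deg w], exactly the threshold in [alike]. *)
Lemma alike_trans u v w : alike u v -> alike v w -> alike u w.
Proof.
move=> uv vw; have := alike_gap uv; have := alike_gap vw.
move: uv vw; rewrite /alike => /and3P[-> _ _] /and3P[_ -> _] /=.
have := dist_triangle u v w; have := deg_dist v u; have := deg_dist v w.
rewrite (distC v u).
have := dist_codeg u v; have := dist_codeg v w; have := dist_codeg u w; lia.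
Qed.

Lemma joined_refl u : joined u u.
Proof. by rewrite /joined eqxx. Qed.

Lemma joinedC u v : joined u v = joined v u.
Proof. by rewrite /joined alikeC eq_sym. Qed.

Lemma joined_trans u v w : joined u v -> joined v w -> joined u w.
Proof.
rewrite /joined => /orP[/eqP->|uv] // /orP[/eqP<-|vw]; first by rewrite uv orbT.
by rewrite (alike_trans uv vw) orbT.
Qed.

Lemma close_deg u v : ~~ far u v -> 10 * deg v <= 12 * deg u.
Proof.
rewrite /far -leqNgt => H; have := dist_codeg u v; have := deg_dist v u.
rewrite (distC v u); lia.
Qed.

Lemma alike_codeg u v : alike u v -> 2 * deg u <= 3 * codeg u v.
Proof.
move=> /alike_gap H; have := dist_codeg u v; have := deg_dist u v; lia.
Qed.

(* Double counting of the pairs [(v, x)] with [v] in the class of [u] and [x] a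
   common neighbour of [u] and [v]. *)
Lemma card_alike u : #|[set v | alike u v]| <= 3 * deg u.
Proof.
have [->|/set0Pn [v0]] := eqVneq [set v | alike u v] set0; first by rewrite cards0.
rewrite inE => /and3P[hu _ _]; move: hu; rewrite /light -leqNgt => hu.
set S := [set v | _].
have H1 : #|S| * (2 * deg u) <= 3 * \sum_(v in S) codeg u v.
  rewrite -sum_nat_const big_distrr /=; apply: leq_sum => v.
  by rewrite inE => /alike_codeg.
have E : \sum_(v in S) codeg u v = \sum_(x in nbhd u) #|nbhd x :&: S|.
  under eq_bigr do rewrite /codeg -sum1_card.
  under [RHS]eq_bigr do rewrite -sum1_card.
  rewrite (exchange_big_dep (mem (nbhd u))) /=; last first.
    by move=> v x _; rewrite inE => /andP[].
  apply: eq_bigr => x xu; apply: eq_bigl => v.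
  by rewrite !in_setI xu (mem_nbhdC v x) andbC.
(* Neighbours of [u] close to it have degree at most 6/5 of [deg u]; the far ones number [bad u],
   and each contributes at most [#|S|]. *)
have H2 : 10 * \sum_(v in S) codeg u v <=
    12 * deg u * deg u + 10 * (bad u * #|S|).
  rewrite E (bigID (far u)) /= mulnDr addnC leq_add //.
    rewrite big_distrr /= (@leq_trans (\sum_(x in nbhd u | ~~ far u x) 12 * deg u)) //.
      apply: leq_sum => x /andP[_ /close_deg]; apply: leq_trans.
      by rewrite leq_mul2l degE subset_leq_card ?orbT // subsetIl.
    rewrite sum_nat_const mulnC leq_mul2l degE; apply/orP; right.
    by apply/subset_leq_card/subsetP => x; move=> /andP[].
  rewrite leq_mul2l /= (@leq_trans (\sum_(x in nbhd u | far u x) #|S|)) //.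
    by apply: leq_sum => x _; rewrite subset_leq_card // subsetIr.
  rewrite sum_nat_const leq_mul2r /bad; apply/orP; right.
  by apply/subset_leq_card/subsetP => x; rewrite in_far_nbhd.
(* With d = [deg u] and s = [#|S|], [H1], [H2] and heaviness give 20/3 d s <= 12 d^2 + 2 d s, hence
   s <= 18/7 d. *)
have := deg_gt0 u; nia.
Qed.

End Clusters.

(** * Charging disagreements to an arbitrary clustering *)

Section Cost.
Variables (R : realFieldType) (V : finType) (G : instance V).

(** Clusterings enter as labellings, so that [pblock] of any partition and the output array are
    treated alike. *)
Definition label_cost (T : eqType) (f : V -> T) (u : V) : nat :=
  #|[set v | (cc_pos G u v && (f u != f v)) || (cc_neg G u v && (f u == f v))]|.

(** For symmetric [e] the kernel is symmetric, so one count of [e]-neighbours bounds row and column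
    sums together. *)
Definition smooth (e : rel V) (z : V -> R) (u : V) : R :=
  \sum_(v | e u v) z v / (deg G u + deg G v)%:R.

Lemma degD_gt0 u v : 0 < (deg G u + deg G v)%:R :> R.
Proof. by rewrite ltr0n addn_gt0 deg_gt0. Qed.

Lemma smooth1_le (m : nat) (e : rel V) u :
  (#|[set v | e u v]| <= m * deg G u)%N -> smooth e (fun=> 1) u <= m%:R.
Proof.
move=> em; have d0 : 0 < (deg G u)%:R :> R by rewrite ltr0n deg_gt0.
apply: (@le_trans _ _ (\sum_(v | e u v) (deg G u)%:R^-1)).
  apply: ler_sum => v _; rewrite div1r lef_pV2 ?posrE ?degD_gt0 //.
  by rewrite ler_nat leq_addr.
rewrite sumr_const -[_^-1 *+ _]mulr_natl ler_pdivrMr // -natrM ler_nat.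
by move: em; rewrite cardsE.
Qed.

Lemma dominated_smooth (m : nat) (e : rel V) (z : V -> R) : symmetric e ->
  (forall u, #|[set v | e u v]| <= m * deg G u)%N ->
  dominated m%:R (smooth e z) z.
Proof.
move=> sym_e em.
exists (fun u v => if e u v then 1 / (deg G u + deg G v)%:R else 0).
split=> [u v|u|v|u].
- by case: ifP => // _; rewrite divr_ge0 // ler0n.
- by rewrite -big_mkcond; apply: smooth1_le.
- apply: le_trans (smooth1_le (em v)).
  rewrite /smooth [leRHS]big_mkcond /=; apply: ler_sum => u _.
  by rewrite sym_e addnC.
- rewrite /smooth big_mkcond /=; apply: ler_sum => v _.
  by case: ifP => _; rewrite ?mul0r // div1r mulrC.
Qed.

Lemma ler_card_sum (A : {set V}) (e : pred V) (w : V -> R) :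
  (forall v, v \in A -> e v && (1 <= w v)) -> (forall v, e v -> 0 <= w v) ->
  #|A|%:R <= \sum_(v | e v) w v.
Proof.
move=> Aw w0; rewrite -sum1_card natr_sum (bigID (mem A) e) /=.
apply: ler_wpDr; first by apply: sumr_ge0 => v /andP[/w0].
rewrite (eq_bigl (fun v => e v && (v \in A))) => [|v]; last first.
  by case vA: (v \in A); rewrite ?andbF //; case/andP: (Aw v vA) => ->.
by apply: ler_sum => v /andP[_ /Aw /andP[]].
Qed.

Section Lower.
Variables (T : eqType) (f : V -> T).
Let y u : R := (label_cost f u)%:R.

(** A vertex in exactly one of the two neighbourhoods is on the same side of [u] and [v] but has
    opposite signs towards them, so it disagrees with one of them. *)
Lemma dist_label_cost u v : f u = f v ->
  (dist G u v <= label_cost f u + label_cost f v)%N.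
Proof.
move=> fuv; rewrite /label_cost -cardsUI; apply: leq_trans (leq_addr _ _).
apply/subset_leq_card/subsetP => x; rewrite !inE /cc_neg -fuv.
have : (u == x) ==> (f u == f x) by apply/implyP => /eqP ->.
have : (v == x) ==> (f u == f x) by rewrite fuv; apply/implyP => /eqP ->.
have : (u == x) ==> ~~ cc_pos G u x by apply/implyP => /eqP ->; rewrite cc_pos_irr.
have : (v == x) ==> ~~ cc_pos G v x by apply/implyP => /eqP ->; rewrite cc_pos_irr.
by case: (u == x); case: (v == x); case: (cc_pos G u x); case: (cc_pos G v x);
  case: (f u == f x).
Qed.

(** A common neighbour can share the label of at most one of [u] and [v]; its positive edge to the
    other is cut. *)
Lemma codeg_label_cost u v : f u != f v ->
  (codeg G u v <= label_cost f u + label_cost f v)%N.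
Proof.
move=> fuv; rewrite /label_cost -cardsUI; apply: leq_trans (leq_addr _ _).
apply/subset_leq_card/subsetP => x; rewrite !inE /cc_neg.
have : (u == x) ==> (f u == f x) by apply/implyP => /eqP ->.
have : (v == x) ==> (f v == f x) by apply/implyP => /eqP ->.
have : (f u == f x) ==> (f v != f x).
  by apply/implyP => /eqP <-; rewrite eq_sym.
by case: (u == x); case: (v == x); case: (cc_pos G u x); case: (cc_pos G v x);
  case: (f u == f x); case: (f v == f x).
Qed.

(** Far neighbours cut by [f] are disagreements at [u]. A far neighbour [v] kept with [u] has
    [deg u + deg v < 11 * (y u + y v)], so it is paid for at rate 11; the share of [y u] sums to at
    most [11 * y u] over the neighbourhood. *)
Lemma bad_smooth_le u :
  (bad G u)%:R <= 12 * y u + 11 * smooth (fun u v => v \in nbhd G u) y u.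
Proof.
have y0 v : 0 <= y v by apply: ler0n.
have -> : bad G u = (#|[set v in far_nbhd G u | f u != f v]| +
    #|[set v in far_nbhd G u | f u == f v]|)%N.
  rewrite /bad -(cardsID [set v | f u == f v]) addnC; congr (_ + _)%N.
    by apply: eq_card => v; rewrite !inE andbC.
  by apply: eq_card => v; rewrite !inE andbC.
rewrite natrD; have -> : 12 * y u = y u + 11 * y u by ring.
rewrite -addrA; apply: lerD.
  rewrite ler_nat; apply/subset_leq_card/subsetP => v; rewrite !inE.
  move=> /andP[/andP[/orP[/eqP <-|->] _] fuv]; first by rewrite eqxx in fuv.
  by rewrite fuv.
have H := @ler_card_sum
  [set v in far_nbhd G u | f u == f v] (fun v => v \in nbhd G u)
  (fun v => 11 * (y u * (1 / (deg G u + deg G v)%:R) + y v / (deg G u + deg G v)%:R)).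
apply: (le_trans (H _ _)) => {H}.
- move=> v; rewrite inE in_far_nbhd => /andP[/andP[vu fuv] /eqP /dist_label_cost].
  rewrite vu /= => H.
  rewrite mulrCA mul1r -mulrDl mulrA ler_pdivlMr ?degD_gt0 // mul1r.
  rewrite -natrD -natrM ler_nat; move: fuv; rewrite /far.
  have := dist_codeg G u v; lia.
- move=> v _; apply: mulr_ge0 => //.
  by rewrite addr_ge0 ?mulr_ge0 ?divr_ge0 ?invr_ge0 ?ler0n.
- rewrite -mulr_sumr -mulrDr ler_wpM2l // big_split /= lerD // -mulr_sumr.
  rewrite -[leRHS]mulr1 ler_wpM2l //.
  apply: (@smooth1_le 1 (fun u v => v \in nbhd G u)).
  by rewrite mul1n degE subset_leq_card //; apply/subsetP => v; rewrite inE.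
Qed.

Variables (T' : eqType) (g : V -> T').
Hypothesis gP : forall u v, (g u == g v) = joined G u v.
Let b u : R := (bad G u)%:R.

Lemma label_cost_light u : light G u -> (label_cost g u <= 5 * bad G u)%N.
Proof.
rewrite /light => lu; apply: leq_trans (ltnW lu); rewrite degE /label_cost.
apply/subset_leq_card/subsetP => v; rewrite !inE gP /cc_neg /joined /alike /light lu.
by case: cc_pos; case: (u == v).
Qed.

(** A positive neighbour separated from [u] is far, or close and light: close heavy vertices are
    always alike. A negative one joined to [u] either disagrees already in [f] or is cut by [f]. *)
Lemma label_cost_heavy u : ~~ light G u ->
  (label_cost g u <= bad G u
     + #|[set v in nbhd G u | ~~ far G u v && light G v]|
     + (label_cost f u + #|[set v | alike G u v && (f u != f v)]|))%N.
Proof.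
move=> hu; have sub : [set v | cc_pos G u v && (g u != g v) || cc_neg G u v && (g u == g v)]
    \subset (far_nbhd G u :|: [set v in nbhd G u | ~~ far G u v && light G v]) :|:
      ([set v | cc_pos G u v && (f u != f v) || cc_neg G u v && (f u == f v)] :|:
       [set v | alike G u v && (f u != f v)]).
  apply/subsetP => v; rewrite !inE gP /cc_neg /joined /alike hu /=.
  have : ~~ far G u v ==> (deg G u + deg G v <= 4 * codeg G u v)%N.
    by apply/implyP; rewrite /far -leqNgt; lia.
  have : (u == v) ==> ~~ cc_pos G u v by apply/implyP => /eqP ->; rewrite cc_pos_irr.
  by case: (u == v); case: (cc_pos G u v); case: (far G u v); case: (light G v);
    case: (_ <= _)%N; case: (f u == f v).
apply: leq_trans (subset_leq_card sub) _.
apply: leq_trans (leq_card_setU _ _).1 _.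
by apply: leq_add; apply: (leq_card_setU _ _).1.
Qed.

(** A close light neighbour [v] has [deg u] at most 6/5 of [deg v] and [deg v < 5 * bad v], so
    [deg u + deg v < 11 * bad v]. *)
Lemma light_nbhd_le u :
  #|[set v in nbhd G u | ~~ far G u v && light G v]|%:R <=
  11 * smooth (fun u v => v \in nbhd G u) b u.
Proof.
have H := @ler_card_sum [set v in nbhd G u | ~~ far G u v && light G v]
  (fun v => v \in nbhd G u) (fun v => 11 * (b v / (deg G u + deg G v)%:R)).
apply: (le_trans (H _ _)) => {H}.
- move=> v; rewrite inE => /and3P[-> nf lv] /=.
  rewrite mulrA ler_pdivlMr ?degD_gt0 // mul1r -natrM ler_nat.
  move: nf; rewrite farC => /close_deg; move: lv; rewrite /light; lia.
- by move=> v _; rewrite mulr_ge0 ?divr_ge0 ?ler0n.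
- by rewrite -mulr_sumr.
Qed.

(** The gap gives [2 * (deg u + deg v) <= 5 * (y u + y v)], hence rate 5/2; [card_alike] bounds the
    share of [y u] by three times that rate. *)
Lemma alike_cut_le u :
  #|[set v | alike G u v && (f u != f v)]|%:R <=
  15 / 2 * y u + 5 / 2 * smooth (alike G) y u.
Proof.
have y0 v : 0 <= y v by apply: ler0n.
have H := @ler_card_sum [set v | alike G u v && (f u != f v)] (alike G u)
  (fun v => 5 / 2 * (y u * (1 / (deg G u + deg G v)%:R) + y v / (deg G u + deg G v)%:R)).
apply: (le_trans (H _ _)) => {H}.
- move=> v; rewrite inE => /andP[uv /codeg_label_cost H]; rewrite uv /=.
  rewrite mulrCA mul1r -mulrDl mulrA ler_pdivlMr ?degD_gt0 // mul1r.
  rewrite mulrAC ler_pdivlMr ?ltr0n // -natrD -!natrM ler_nat.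
  have := alike_gap uv; lia.
- move=> v _; apply: mulr_ge0; first by rewrite divr_ge0.
  by rewrite addr_ge0 ?mulr_ge0 ?divr_ge0 ?invr_ge0 ?ler0n.
- rewrite -mulr_sumr big_split /= -mulr_sumr mulrDr lerD2r.
  have -> : 15 / 2 * y u = 5 / 2 * (y u * 3%:R) by field.
  apply: ler_wpM2l; first by rewrite divr_ge0.
  apply: ler_wpM2l => //.
  exact: smooth1_le (card_alike G u).
Qed.

Lemma label_cost_le u : (label_cost g u)%:R <=
  5 * b u + 11 * smooth (fun u v => v \in nbhd G u) b u +
  (17 / 2 * y u + 5 / 2 * smooth (alike G) y u).
Proof.
have b0 : 0 <= b u by apply: ler0n.
have y0 v : 0 <= y v by apply: ler0n.
have [lu|hu] := boolP (light G u).
  rewrite (@le_trans _ _ (5 * b u)) //.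
    by rewrite -natrM ler_nat label_cost_light.
  have s0 e z : (forall v, 0 <= z v) -> 0 <= smooth e z u.
    by move=> z0; apply: sumr_ge0 => v _; rewrite divr_ge0 // ltW // degD_gt0.
  have := s0 (alike G) y y0.
  have := s0 (fun u v => v \in nbhd G u) b (fun v => ler0n _ _).
  have := y0 u; lra.
have := label_cost_heavy hu; rewrite -(ler_nat R) !natrD => /le_trans; apply.
have := light_nbhd_le u; have := alike_cut_le u; rewrite -/(b u) -/(y u); lra.
Qed.

(** [bad] is first dominated by [y] with constant 12 + 11 = 23 and then substituted; the factor 3
    comes from [card_alike]. In total 16 * 23 + 16 = 384. *)
Lemma dominated_label_cost :
  dominated 384 (fun u => (label_cost g u)%:R : R) (fun u => (label_cost f u)%:R).
Proof.
have symN : symmetric (fun u v => v \in nbhd G u) by move=> u v; rewrite mem_nbhdC.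
have cardN u : (#|[set v | v \in nbhd G u]| <= 1 * deg G u)%N.
  by rewrite mul1n degE subset_leq_card //; apply/subsetP => v; rewrite inE.
have domP z := dominated_smooth z symN cardN.
have domQ z := dominated_smooth z (@alikeC V G) (card_alike G).
have domb : dominated 23 b y.
  apply: (dominated_le bad_smooth_le).
  have -> : 23 = 12 * 1 + 11 * 1 :> R by ring.
  apply: dominated_add; apply: dominated_scale => //; exact: dominated_refl.
apply: (dominated_le label_cost_le).
have -> : 384 = 5 * 23 + 11 * (1 * 23) + (17 / 2 * 1 + 5 / 2 * 3) :> R by field.
apply: dominated_add; apply: dominated_add; apply: dominated_scale => //.
- exact: (dominated_trans ler01 (ler0n _ 23) (domP b) domb).
- by rewrite divr_ge0.
- exact: dominated_refl.
- by rewrite divr_ge0.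
Qed.

End Lower.
End Cost.

Lemma lp_label_cost_le (R : realType) (V : finType) (G : instance V)
    (T T' : eqType) (f : V -> T) (g : V -> T') (p : \bar R) :
  (forall u v, (g u == g v) = joined G u v) -> (1 <= p)%E ->
  lp_norm p (fun u => (label_cost G g u)%:R) <=
  384 * lp_norm p (fun u => (label_cost G f u)%:R).
Proof.
move=> gP p1; apply: dominated_lp_norm => //; try by move=> u; apply: ler0n.
exact: dominated_label_cost.
Qed.

Lemma cc_cost_le_OPT (R : realType) (n : nat) (G : instance 'I_n) (s : store)
    (p : \bar R) :
  (forall u v : 'I_n, (arrs s 2 u == arrs s 2 v) = joined G u v) -> (1 <= p)%E ->
  cc_cost G p (cc_output n s) <= 384 * OPT G p.
Proof.
move=> sP p1; apply: le_trans (lp_label_cost_le (pblock _) sP p1).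
rewrite /cc_cost le_eqVlt; apply/orP; left; apply/eqP; congr lp_norm.
apply: boolp.funext => u; congr (_%:R); rewrite /disagreements /label_cost.
have /and3P[/eqP cov tiv _] := preim_partitionP (fun u : 'I_n => arrs s 2 u) [set: 'I_n].
have same v : (pblock (cc_output n s) u == pblock (cc_output n s) v) =
    (arrs s 2 u == arrs s 2 v).
  rewrite /cc_output eq_pblock ?cov //.
  rewrite (pblock_equivalence_partition (R := fun x y : 'I_n => arrs s 2 x == arrs s 2 y)) ?inE //.
  by move=> x y z _ _ _; split => // /eqP ->.
by apply: eq_card => v; rewrite !inE /disagreement same.
Qed.

(** * Program logic *)

Section Language.
Local Open Scope nat_scope.

Lemma word_le W W' z x : W <= W' -> word W z = Some x -> word W' z = Some x.
Proof. by rewrite /word => WW'; case: ifP => // zW; rewrite (leq_trans zW WW'). Qed.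

Lemma eval_expr_le W W' s e z : W <= W' ->
  eval_expr W s e = Some z -> eval_expr W' s e = Some z.
Proof.
move=> WW'; elim: e z => [c|x|a e IH|o e1 IH1 e2 IH2] z /=; try exact: word_le.
- case E: (eval_expr W s e) => [[i|]|] //; rewrite (IH _ E); exact: word_le.
- case E1: (eval_expr W s e1) => [x|] //; case E2: (eval_expr W s e2) => [y|] //.
  rewrite (IH1 _ E1) (IH2 _ E2); exact: word_le.
Qed.

Lemma exec_le W W' c s t s' : W <= W' -> exec W c s t s' -> exec W' c s t s'.
Proof.
move=> WW'; elim=> {c s t s'}; try by [constructor].
- by move=> x e z s /(eval_expr_le WW'); constructor.
- by move=> a e1 e2 i z s /(eval_expr_le WW') ? /(eval_expr_le WW'); constructor.
- by move=> c1 c2 s1 s2 s3 t1 t2 _ H1 _ H2; apply: ExecSeq H1 H2.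
- by move=> e c1 c2 z s s' t /(eval_expr_le WW') H _ H1; apply: ExecIf H H1.
- by move=> e c s /(eval_expr_le WW'); constructor.
- move=> e c z s1 s2 s3 t1 t2 /(eval_expr_le WW') H z0 _ H1 _ H2.
  exact: ExecWhileStep H z0 H1 H2.
Qed.

(** One strict upper bound for register and array names together, so that every name from it on is
    free for a calling program. *)
Fixpoint expr_names (e : expr) : nat :=
  match e with
  | Const _ => 0
  | Reg x => x.+1
  | Read a e1 => maxn a.+1 (expr_names e1)
  | Bin _ e1 e2 => maxn (expr_names e1) (expr_names e2)
  end.

Fixpoint cmd_names (c : cmd) : nat :=
  match c with
  | Skip => 0
  | Assign x e => maxn x.+1 (expr_names e)
  | Write a e1 e2 => maxn a.+1 (maxn (expr_names e1) (expr_names e2))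
  | Seq c1 c2 => maxn (cmd_names c1) (cmd_names c2)
  | If e c1 c2 => maxn (expr_names e) (maxn (cmd_names c1) (cmd_names c2))
  | While e c1 => maxn (expr_names e) (cmd_names c1)
  end.

Definition agree_on (P : pred nat) (s r : store) : Prop :=
  (forall x, P x -> regs s x = regs r x) /\
  (forall a, P a -> forall i, arrs s a i = arrs r a i).

Lemma eval_expr_agree W F s r e : expr_names e <= F ->
  agree_on (fun x => x < F) s r -> eval_expr W s e = eval_expr W r e.
Proof.
move=> + [sr sa]; elim: e => [c|x|a e IH|o e1 IH1 e2 IH2] //=.
- by move=> xF; rewrite sr.
- rewrite geq_max => /andP[aF /IH ->].
  by case: eval_expr => // -[i|] //; rewrite sa.
- by rewrite geq_max => /andP[/IH1 -> /IH2 ->].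
Qed.

(* [M] cannot notice what its caller keeps in registers and arrays that it does
   not name, and leaves them alone. *)
Lemma exec_agree W F c s t s' r : exec W c s t s' -> cmd_names c <= F ->
  agree_on (fun x => x < F) s r ->
  exists r', [/\ exec W c r t r', agree_on (fun x => x < F) s' r'
               & agree_on (leq F) r r'].
Proof.
move=> E; elim: E r => {c s t s'} /=.
- by move=> s r _ sr; exists r; split => //; constructor.
- move=> x e z s ez r; rewrite geq_max => /andP[xF eF] sr.
  exists (set_reg r x z); split.
  + by constructor; rewrite -(eval_expr_agree W eF sr).
  + by case: sr => sr sa; split => // y yF; rewrite /= /upd sr.
  + by split => // y Fy; rewrite /= /upd gtn_eqF // (leq_trans xF).
- move=> a e1 e2 i z s ei ez r; rewrite !geq_max => /and3P[aF e1F e2F] sr.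
  exists (set_cell r a i z); split.
  + by constructor; rewrite -(eval_expr_agree W _ sr).
  + case: sr => sr sa; split => // b bF j /=; rewrite /upd.
    by case: (b =P a) => [_|_]; rewrite ?sa.
  + by split => // b Fb j; rewrite /= /upd gtn_eqF // (leq_trans aF).
- move=> c1 c2 s1 s2 s3 t1 t2 _ IH1 _ IH2 r; rewrite geq_max => /andP[c1F c2F] sr.
  have [r1 [E1 A1 B1]] := IH1 r c1F sr; have [r2 [E2 A2 B2]] := IH2 r1 c2F A1.
  exists r2; split => //; first exact: ExecSeq E1 E2.
  case: B1 => B1 B1'; case: B2 => B2 B2'; split=> [x xF|a aF i].
    by rewrite B1 ?B2.
  by rewrite B1' ?B2'.
- move=> e c1 c2 z s s' t ez _ IH r; rewrite !geq_max => /and3P[eF c1F c2F] sr.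
  have [|r1 [E1 A1 B1]] := IH r _ sr; first by case: ifP.
  exists r1; split => //; apply: ExecIf E1.
  by rewrite -(eval_expr_agree W eF sr).
- move=> e c s ez r; rewrite geq_max => /andP[eF cF] sr.
  exists r; split => //; apply: ExecWhileEnd.
  by rewrite -(eval_expr_agree W eF sr).
- move=> e c z s1 s2 s3 t1 t2 ez z0 _ IH1 _ IH2 r ecF sr.
  move: (ecF); rewrite geq_max => /andP[eF cF].
  have [r1 [E1 A1 B1]] := IH1 r cF sr; have [r2 [E2 A2 B2]] := IH2 r1 ecF A1.
  exists r2; split => //.
    by apply: (ExecWhileStep _ z0 E1 E2); rewrite -(eval_expr_agree W eF sr).
  case: B1 => B1 B1'; case: B2 => B2 B2'; split=> [x xF|a aF i].
    by rewrite B1 ?B2.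
  by rewrite B1' ?B2'.
Qed.

(** One step writes at most one cell; this yields the lower bound n^2 on multiplication time. *)
Lemma exec_changed_cells W c s t s' a m : exec W c s t s' ->
  \sum_(i < m) (arrs s a i != arrs s' a i) <= t.
Proof.
elim=> {c s t s'}.
- by move=> s; rewrite big1 // => i _; rewrite eqxx.
- by move=> x e z s _; rewrite big1 // => i _; rewrite eqxx.
- move=> b e1 e2 j z s _ _; apply: (@leq_trans 1) => //.
  have [jm|jm] := ltnP j m.
    rewrite (bigD1 (Ordinal jm)) //= big1 => [|i ij]; first by rewrite addn0 leq_b1.
    rewrite /upd; case: (a =P b) => [->|_] /=; last by rewrite eqxx.
    by move: ij; rewrite -val_eqE /= => /negPf ->; rewrite eqxx.
  rewrite big1 // => i _ /=; rewrite /upd.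
  case: (a =P b) => [->|_] /=; last by rewrite eqxx.
  by rewrite ltn_eqF ?eqxx // (leq_trans (ltn_ord i)).
- move=> c1 c2 s1 s2 s3 t1 t2 _ H1 _ H2; apply: leq_trans (leq_add H1 H2).
  rewrite -big_split /=; apply: leq_sum => i _.
  case: (arrs s1 a i =P arrs s2 a i) => [->|_]; first exact: leq_addl.
  exact: leq_trans (leq_b1 _) (leq_addr _ _).
- by move=> e c1 c2 z s s' t _ _ H; apply: leq_trans (leq_addl _ _).
- by move=> e c s _; rewrite big1 // => i _; rewrite eqxx.
- move=> e c z s1 s2 s3 t1 t2 _ _ _ H1 _ H2.
  rewrite -addnA; apply: leq_trans (leq_addl _ _); apply: leq_trans (leq_add H1 H2).
  rewrite -big_split /=; apply: leq_sum => i _.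
  case: (arrs s1 a i =P arrs s2 a i) => [->|_]; first exact: leq_addl.
  exact: leq_trans (leq_b1 _) (leq_addr _ _).
Qed.

Lemma halts_weaken W c s t t' (Q Q' : store -> Prop) : t <= t' ->
  (forall s', Q s' -> Q' s') -> halts_within W c s t Q -> halts_within W c s t' Q'.
Proof.
move=> tt' QQ' [k [s' [E kt Qs]]]; exists k, s'; split => //; last exact: QQ'.
exact: leq_trans kt tt'.
Qed.

Lemma halts_skip W s t (Q : store -> Prop) : 0 < t -> Q s -> halts_within W Skip s t Q.
Proof. by move=> t0 Qs; exists 1, s; split => //; constructor. Qed.

Lemma halts_assign W x e z s t (Q : store -> Prop) : eval_expr W s e = Some z ->
  expr_cost e < t -> Q (set_reg s x z) -> halts_within W (Assign x e) s t Q.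
Proof. by move=> ez et Qs; eexists _, _; split; [constructor; apply: ez| |]. Qed.

Lemma halts_write W a e1 e2 (i : nat) z s t (Q : store -> Prop) :
  eval_expr W s e1 = Some (Posz i) -> eval_expr W s e2 = Some z ->
  expr_cost e1 + expr_cost e2 < t -> Q (set_cell s a i z) ->
  halts_within W (Write a e1 e2) s t Q.
Proof. by move=> e1i e2z et Qs; eexists _, _; split; [constructor; eassumption| |]. Qed.

Lemma halts_seq W c1 c2 s t1 t2 (P Q : store -> Prop) : halts_within W c1 s t1 P ->
  (forall s', P s' -> halts_within W c2 s' t2 Q) ->
  halts_within W (Seq c1 c2) s (t1 + t2) Q.
Proof.
move=> [k1 [s1 [E1 kt1 P1]]] /(_ _ P1) [k2 [s2 [E2 kt2 Q2]]].
by exists (k1 + k2), s2; split; [apply: ExecSeq E1 E2|apply: leq_add|].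
Qed.

Lemma halts_if W e c1 c2 z s t (Q : store -> Prop) : eval_expr W s e = Some z ->
  halts_within W (if z != 0%R then c1 else c2) s t Q ->
  halts_within W (If e c1 c2) s ((expr_cost e).+1 + t) Q.
Proof.
move=> ez [k [s' [E kt Qs]]]; exists ((expr_cost e).+1 + k), s'.
by split; [apply: ExecIf ez E|rewrite leq_add2l|].
Qed.

Definition evaln (W : nat) (s : store) (e : expr) (k : nat) : Prop :=
  eval_expr W s e = Some (Posz k).

Section Evaln.
Variables (W : nat) (s : store).

Lemma wordn k : k <= W -> word W (Posz k) = Some (Posz k).
Proof. by rewrite /word absz_nat => ->. Qed.

Lemma evaln_const (k : nat) : k <= W -> evaln W s (Const (Posz k)) k.
Proof. exact: wordn. Qed.

Lemma evaln_reg x k : regs s x = Posz k -> k <= W -> evaln W s (Reg x) k.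
Proof. by rewrite /evaln /= => ->; apply: wordn. Qed.

Lemma evaln_read a e i k : evaln W s e i -> arrs s a i = Posz k -> k <= W ->
  evaln W s (Read a e) k.
Proof. by rewrite /evaln /= => -> ->; apply: wordn. Qed.

Lemma evaln_add e1 e2 k1 k2 : evaln W s e1 k1 -> evaln W s e2 k2 -> k1 + k2 <= W ->
  evaln W s (Bin Add e1 e2) (k1 + k2).
Proof. by rewrite /evaln /= => -> -> h; rewrite -PoszD wordn. Qed.

Lemma evaln_sub e1 e2 k1 k2 : evaln W s e1 k1 -> evaln W s e2 k2 -> k2 <= k1 ->
  k1 - k2 <= W -> evaln W s (Bin Defs.Sub e1 e2) (k1 - k2).
Proof. by rewrite /evaln /= => -> -> h1 h2; rewrite subzn // wordn. Qed.

Lemma evaln_mul e1 e2 k1 k2 : evaln W s e1 k1 -> evaln W s e2 k2 -> k1 * k2 <= W ->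
  evaln W s (Bin Mul e1 e2) (k1 * k2).
Proof. by rewrite /evaln /= => -> -> h; rewrite -PoszM wordn. Qed.

Lemma evaln_div e1 e2 k1 k2 : evaln W s e1 k1 -> evaln W s e2 k2 -> k1 %/ k2 <= W ->
  evaln W s (Bin Div e1 e2) (k1 %/ k2).
Proof. by rewrite /evaln /= => -> -> h; rewrite divz_nat wordn. Qed.

Lemma evaln_lt e1 e2 k1 k2 : evaln W s e1 k1 -> evaln W s e2 k2 -> 0 < W ->
  evaln W s (Bin Lt e1 e2) (k1 < k2).
Proof. by rewrite /evaln /= => -> -> h; rewrite ltz_nat wordn //; case: ltnP. Qed.

Lemma evaln_eq e1 e2 k1 k2 : evaln W s e1 k1 -> evaln W s e2 k2 -> 0 < W ->
  evaln W s (Bin Eq e1 e2) (k1 == k2).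
Proof. by rewrite /evaln /= => -> -> h; rewrite eqz_nat wordn //; case: eqP. Qed.

End Evaln.
End Language.

(** * A loop over all matrix cells *)

Section Loop.
Local Open Scope nat_scope.
Variables (rI rL : nat).

Definition for_all_cells (body : cmd) : cmd :=
  Seq (Assign rI (Const (Posz 0)))
    (While (Bin Lt (Reg rI) (Reg rL))
       (Seq body (Assign rI (Bin Add (Reg rI) (Const (Posz 1)))))).

Lemma halts_for_all_cells W n body tb (Inv : nat -> store -> Prop) s :
  n * n < W ->
  (forall i s, Inv i s -> regs s rL = Posz (n * n)) ->
  (forall i s k, Inv i s -> Inv i (set_reg s rI (Posz k))) ->
  (forall (u v : 'I_n) s, Inv (u * n + v) s -> regs s rI = Posz (u * n + v) ->
     halts_within W body s tb
       (fun s' => Inv (u * n + v).+1 s' /\ regs s' rI = Posz (u * n + v))) ->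
  Inv 0 s ->
  halts_within W (for_all_cells body) s (2 + (n * n * (tb + 8) + 4)) (Inv (n * n)).
Proof.
move=> nW limI regI stepI I0.
apply: (@halts_seq _ _ _ _ _ _ (fun s => Inv 0 s /\ regs s rI = Posz 0)).
  apply: halts_assign; [exact: evaln_const|by []|split].
    exact: regI.
  by rewrite /= /upd eqxx.
(* Induction on the number [k] of cells left. Besides the body, a round costs 4 for the test and 4
   for the increment; the failing test costs the last 4. *)
have loop k i s1 : i + k = n * n -> Inv i s1 -> regs s1 rI = Posz i ->
    halts_within W (While (Bin Lt (Reg rI) (Reg rL))
       (Seq body (Assign rI (Bin Add (Reg rI) (Const (Posz 1)))))) s1
       (k * (tb + 8) + 4) (Inv (n * n)).
  elim: k i s1 => [|k IH] i s1.
    rewrite addn0 => -> I1 r1; exists 4, s1; split => //.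
    have e0 : evaln W s1 (Bin Lt (Reg rI) (Reg rL)) (n * n < n * n).
      by apply: evaln_lt; [apply: evaln_reg r1 _|apply: evaln_reg (limI _ _ I1) _|]; lia.
    by apply: (ExecWhileEnd (e := Bin Lt (Reg rI) (Reg rL))); rewrite e0 ltnn.
  move=> ik I1 r1; have im : i < n * n by lia.
  have n0 : 0 < n by case: n im {nW limI regI stepI I0 IH ik I1} => //; rewrite muln0.
  have e1 : evaln W s1 (Bin Lt (Reg rI) (Reg rL)) (i < n * n).
    by apply: evaln_lt; [apply: evaln_reg r1 _|apply: evaln_reg (limI _ _ I1) _|]; lia.
  have un : i %/ n < n by rewrite ltn_divLR.
  have vn : i %% n < n by rewrite ltn_mod.
  have iE : i = Ordinal un * n + Ordinal vn by rewrite /= -divn_eq.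
  rewrite iE in I1 r1; have [t2 [s2 [E2 le2 [I2 r2]]]] := stepI _ _ _ I1 r1.
  rewrite -iE in I2 r2.
  have e2 : evaln W s2 (Bin Add (Reg rI) (Const (Posz 1))) (i + 1).
    by apply: evaln_add; [apply: evaln_reg r2 _|apply: evaln_const|]; lia.
  have [|||t3 [s3 [E3 le3 I3]]] := IH i.+1 (set_reg s2 rI (Posz (i + 1))).
  - by rewrite -ik addSnnS.
  - exact: regI.
  - by rewrite /= /upd eqxx addn1.
  exists (4 + (t2 + 4) + t3), s3; split => //; last by rewrite mulSn; lia.
  apply: (ExecWhileStep (e := Bin Lt (Reg rI) (Reg rL)) e1 _ _ E3).
    by rewrite im.
  by apply: ExecSeq E2 _; apply: (@ExecAssign _ _ (Bin Add (Reg rI) (Const (Posz 1))) _ _ e2).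
by move=> s1 [I1 r1]; apply: loop r1.
Qed.

End Loop.

(** * The program *)

Section Program.
Local Open Scope nat_scope.
(* [rN], [rI], [rL]: registers for n, the loop counter and n * n.  [aN], [aP],
   [aB]: arrays for the closed adjacency matrix, its square and [bad]. *)
Variables rN rI rL aN aP aB : nat.

Definition cell : expr := Reg rI.
Definition cell_row : expr := Bin Div cell (Reg rN).
Definition cell_col : expr := Bin Defs.Sub cell (Bin Mul cell_row (Reg rN)).
Definition common (a : nat) : expr := Read a cell.
Definition degree (a : nat) (e : expr) : expr :=
  Read a (Bin Add (Bin Mul e (Reg rN)) e).
Definition degrees (a : nat) : expr := Bin Add (degree a cell_row) (degree a cell_col).
Definition const (k : nat) : expr := Const (Posz k).
Definition is_far (a : nat) : expr :=
  Bin Lt (Bin Mul (const 11) (common a)) (Bin Mul (const 5) (degrees a)).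
(* Integers allow [k + 1] on the right of [Lt] to express a weak inequality. *)
Definition is_heavy (a : nat) (e : expr) : expr :=
  Bin Lt (Bin Mul (const 5) (Read aB e)) (Bin Add (degree a e) (const 1)).
Definition is_alike (a : nat) : expr :=
  Bin Mul (Bin Mul (is_heavy a cell_row) (is_heavy a cell_col))
    (Bin Lt (degrees a) (Bin Add (Bin Mul (const 4) (common a)) (const 1))).
Definition is_joined (a : nat) : expr := Bin Add (Bin Eq cell_row cell_col) (is_alike a).

Definition prelude : cmd :=
  Seq (Assign rN (Reg 0)) (Assign rL (Bin Mul (Reg rN) (Reg rN))).
(** Arrays 0 and 1 are the two factors for [M], which may destroy them; the copy in [aN]
    survives. *)
Definition close_body : cmd :=
  Seq (Write 0 cell (Bin Add (Read 0 cell) (Bin Eq cell_row cell_col)))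
    (Seq (Write 1 cell (Read 0 cell)) (Write aN cell (Read 0 cell))).
(** The square moves to [aP] because array 2 is later overwritten by cluster names. The cells of a
    row accumulate in one counter of [aB]. *)
Definition bad_body : cmd :=
  Seq (Write aP cell (Read 2 cell))
    (Write aB cell_row (Bin Add (Read aB cell_row) (Bin Mul (Read aN cell) (is_far 2)))).
(* The last write wins, so the name of a vertex is the largest vertex joined to it. *)
Definition name_body : cmd :=
  If (is_joined aP) (Write 2 cell_col cell_row) Skip.
Definition cc_program (M : cmd) : cmd :=
  Seq prelude (Seq (for_all_cells rI rL close_body)
    (Seq M (Seq (for_all_cells rI rL bad_body) (for_all_cells rI rL name_body)))).

Variables (W n : nat) (G : instance 'I_n).
Hypothesis W_large : 64 * (n + 2) ^ 2 <= W.
Hypothesis lt_regs : [&& 0 < rN, rN < rI & rI < rL].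
Hypothesis lt_arrs : [&& 2 < aN, aN < aP & aP < aB].

Lemma neq_regsE : ((rN == rI) = false) * ((rN == rL) = false) * ((rI == rL) = false) *
  ((rI == rN) = false) * ((rL == rN) = false) * ((rL == rI) = false).
Proof. by do !split; apply/eqP; lia. Qed.

Lemma neq_arrsE :
  ((aN == 0) = false) * ((aN == 1) = false) * ((aN == 2) = false) * ((aN == aP) = false) *
  ((aN == aB) = false) * ((aP == 0) = false) * ((aP == 1) = false) * ((aP == 2) = false) *
  ((aP == aN) = false) * ((aP == aB) = false) * ((aB == 0) = false) * ((aB == 1) = false) *
  ((aB == 2) = false) * ((aB == aN) = false) * ((aB == aP) = false) *
  ((0 == aN) = false) * ((1 == aN) = false) * ((2 == aN) = false) *
  ((0 == aP) = false) * ((1 == aP) = false) * ((2 == aP) = false) *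
  ((0 == aB) = false) * ((1 == aB) = false) * ((2 == aB) = false).
Proof. by do !split; apply/eqP; lia. Qed.

Lemma cells_le_word : n * n + 64 * n + 64 <= W.
Proof. by apply: leq_trans W_large; rewrite expnS expn1; nia. Qed.

Lemma cell_ltn (u v : 'I_n) : u * n + v < n * n.
Proof. have := ltn_ord u; have := ltn_ord v; nia. Qed.

Lemma cell_div (u v : 'I_n) : (u * n + v) %/ n = u.
Proof.
by rewrite divnMDl ?divn_small ?addn0 //; apply: leq_ltn_trans (ltn_ord u).
Qed.

Lemma codeg_le u v : codeg G u v <= n.
Proof. by rewrite -[X in _ <= X]card_ord max_card. Qed.

Lemma deg_le u : deg G u <= n.
Proof. exact: codeg_le. Qed.

Lemma bad_le u : bad G u <= n.
Proof. by rewrite -[X in _ <= X]card_ord max_card. Qed.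

Definition closed_matrix : 'M[int]_n := \matrix_(u, v) Posz (v \in nbhd G u).

Lemma mx_arrayE (A : 'M[int]_n) (u v : 'I_n) : mx_array A (u * n + v) = A u v.
Proof.
have n0 : 0 < n by case: n u => // -[].
rewrite /mx_array divnMDl // divn_small // addn0 modnMDl modn_small //.
by rewrite !insubT //= => hu hv; congr (A _ _); apply: val_inj.
Qed.

Lemma closed_matrix_mul (u v : 'I_n) :
  (closed_matrix *m closed_matrix)%R u v = Posz (codeg G u v).
Proof.
rewrite mxE /codeg -sum1_card (big_morph Posz PoszD (erefl _)) [RHS]big_mkcond /=.
apply: eq_bigr => w _; rewrite !mxE (mem_nbhdC G v w) in_setI.
by case: (w \in nbhd G u); case: (w \in nbhd G v).
Qed.

Section Evaluation.
Variables (s : store) (u v : 'I_n).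
Hypotheses (sN : regs s rN = Posz n) (sI : regs s rI = Posz (u * n + v)).

Lemma evaln_cell : evaln W s cell (u * n + v).
Proof. by apply: evaln_reg sI _; have := cell_ltn u v; have := cells_le_word; lia. Qed.

Lemma evaln_n : evaln W s (Reg rN) n.
Proof. by apply: evaln_reg sN _; have := cells_le_word; lia. Qed.

Lemma evaln_row : evaln W s cell_row u.
Proof.
rewrite -[X in evaln _ _ _ X](cell_div u v); apply: evaln_div evaln_cell evaln_n _.
by rewrite cell_div; have := ltn_ord u; have := cells_le_word; lia.
Qed.

Lemma evaln_col : evaln W s cell_col v.
Proof.
have -> : nat_of_ord v = u * n + v - u * n by rewrite addKn.
have := cell_ltn u v; have := cells_le_word => hW huv.
by apply: evaln_sub evaln_cell (evaln_mul evaln_row evaln_n _) _ _; lia.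
Qed.

Section Square.
Variable a : nat.
Hypothesis aE : forall x y : 'I_n, arrs s a (x * n + y) = Posz (codeg G x y).

Lemma evaln_common : evaln W s (common a) (codeg G u v).
Proof.
apply: evaln_read evaln_cell (aE u v) _.
by have := codeg_le u v; have := cells_le_word; lia.
Qed.

Lemma evaln_degree e (x : 'I_n) : evaln W s e x -> evaln W s (degree a e) (deg G x).
Proof.
move=> ex; have := cell_ltn x x; have := deg_le x; have := cells_le_word => hW hd hx.
apply: (evaln_read (k := deg G x) (evaln_add (evaln_mul ex evaln_n _) ex _) (aE x x)); lia.
Qed.

Lemma evaln_degrees : evaln W s (degrees a) (deg G u + deg G v).
Proof.
apply: evaln_add (evaln_degree evaln_row) (evaln_degree evaln_col) _.
by have := deg_le u; have := deg_le v; have := cells_le_word; lia.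
Qed.

Lemma evaln_constant k : k <= 64 -> evaln W s (const k) k.
Proof. by move=> k64; apply: evaln_const; have := cells_le_word; lia. Qed.

Lemma evaln_far : evaln W s (is_far a) (far G u v).
Proof.
have := deg_le u; have := deg_le v => hv hu.
have := codeg_le u v; have := cells_le_word => hW huv.
apply: evaln_lt; last lia.
  by apply: evaln_mul evaln_common _; [apply: evaln_constant|lia].
by apply: evaln_mul evaln_degrees _; [apply: evaln_constant|lia].
Qed.

Hypothesis bE : forall x : 'I_n, arrs s aB x = Posz (bad G x).

Lemma evaln_heavy e (x : 'I_n) : evaln W s e x ->
  evaln W s (is_heavy a e) (~~ light G x).
Proof.
move=> ex; have := bad_le x; have := deg_le x; have := cells_le_word => hW hd hb.
have -> : ~~ light G x = (5 * bad G x < deg G x + 1).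
  by rewrite /light -leqNgt addn1 ltnS.
apply: evaln_lt; last lia.
  by apply: (evaln_mul (evaln_constant _) (evaln_read ex (bE x) _)); lia.
by apply: (evaln_add (evaln_degree ex) (evaln_constant _)); lia.
Qed.

Lemma evaln_alike : evaln W s (is_alike a) (alike G u v).
Proof.
have := codeg_le u v; have := cells_le_word => hW huv.
have -> : alike G u v = ((~~ light G u : nat) * (~~ light G v) *
    (deg G u + deg G v < 4 * codeg G u v + 1)) :> nat.
  by rewrite /alike addn1 ltnS; do 2![case: (light G _) => //=]; case: leqP.
have := deg_le u; have := deg_le v => hv hu.
apply: evaln_mul; first last.
- by case: (light G u); case: (light G v); case: (_ < _) => /=; lia.
- apply: evaln_lt; [exact: evaln_degrees| |lia].
  apply: evaln_add; [|apply: evaln_constant|]; try lia.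
  by apply: evaln_mul evaln_common _; [apply: evaln_constant|lia].
- apply: (evaln_mul (evaln_heavy evaln_row) (evaln_heavy evaln_col)).
  by case: (light G u); case: (light G v) => /=; lia.
Qed.

Lemma evaln_joined :
  exists2 k : nat, evaln W s (is_joined a) k & (k != 0) = joined G u v.
Proof.
(* On the diagonal both summands can be 1, so only being nonzero is meaningful. *)
exists ((val u == val v) + alike G u v); last first.
  by rewrite /joined val_eqE; case: (u == v); case: alike.
have hW := cells_le_word.
apply: evaln_add evaln_alike _; last by case: (_ == _); case: alike => /=; lia.
by apply: evaln_eq evaln_row evaln_col _; lia.
Qed.

End Square.
End Evaluation.

Lemma set_cellE s a i z b j :
  arrs (set_cell s a i z) b j = if (b == a) && (j == i) then z else arrs s b j.
Proof. by rewrite /= /upd; case: eqP => [->|]. Qed.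

Lemma set_regE s x z y : regs (set_reg s x z) y = if y == x then z else regs s y.
Proof. by []. Qed.

(** The conditions on small registers and untouched arrays make the final store look like
    [init_store] to [M], and keep the counters in [aB] at zero. *)
Definition closed_upto (i : nat) (s : store) : Prop :=
  [/\ regs s rN = Posz n /\ regs s rL = Posz (n * n),
      forall x, x < rN -> regs s x = upd (fun=> 0%R) 0 (Posz n) x,
      forall k, arrs s 0 k = mx_array (if k < i then closed_matrix else cc_matrix G) k,
      forall a k, (a == 1) || (a == aN) -> arrs s a k =
        if k < i then mx_array closed_matrix k else 0%R
    & forall a k, 1 < a -> a != aN -> arrs s a k = 0%R].

Lemma close_body_spec (u v : 'I_n) s :
  closed_upto (u * n + v) s -> regs s rI = Posz (u * n + v) ->
  halts_within W close_body s 100 (fun s' =>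
    closed_upto (u * n + v).+1 s' /\ regs s' rI = Posz (u * n + v)).
Proof.
move=> [[sN sL] s_regs s0 s1 s2] sI; set k0 := u * n + v in s0 s1 sI *.
have hW := cells_le_word; set b := (v \in nbhd G u) : nat.
have bW : b <= W by rewrite /b; case: (v \in _) => /=; lia.
have bE : mx_array closed_matrix k0 = Posz b by rewrite mx_arrayE mxE.
have e0 : evaln W s (Bin Add (Read 0 cell) (Bin Eq cell_row cell_col)) b.
  have -> : b = cc_pos G u v + (val u == val v) :> nat.
    rewrite /b inE val_eqE; case: (eqVneq u v) => [->|_] /=; first by rewrite cc_pos_irr.
    by rewrite addn0.
  apply: evaln_add; last by case: cc_pos; case: (_ == _) => /=; lia.
    apply: evaln_read (evaln_cell sN sI) _ _; last by case: cc_pos => /=; lia.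
    by rewrite s0 ltnn mx_arrayE mxE.
  by apply: evaln_eq (evaln_row sN sI) (evaln_col sN sI) _; lia.
have step a s' : regs s' = regs s -> arrs s' 0 k0 = Posz b ->
    halts_within W (Write a cell (Read 0 cell)) s' 10 (eq (set_cell s' a k0 (Posz b))).
  move=> s'R s'0; have ec : evaln W s' cell k0 by apply: evaln_cell; rewrite s'R.
  by apply: halts_write ec (evaln_read ec s'0 bW) _ _.
apply: (@halts_weaken _ _ _ (80 + (10 + 10)) _ (fun s' => s' = set_cell (set_cell
  (set_cell s 0 k0 (Posz b)) 1 k0 (Posz b)) aN k0 (Posz b))) => //.
  move=> _ ->; split=> //; split=> //.
  - move=> k; rewrite !set_cellE !neq_arrsE /= ltnS leq_eqVlt.
    by case: eqP => [->|_] /=; rewrite ?s0 ?bE // !orbF.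
  - move=> a k; rewrite !set_cellE ltnS leq_eqVlt => /orP[]/eqP-> /=.
      rewrite !neq_arrsE /=; case: eqP => [->|_] /=; rewrite ?bE // s1 //.
    rewrite !neq_arrsE eqxx /=; case: eqP => [->|_] /=; rewrite ?bE // s1 ?eqxx ?orbT //.
  - move=> a k a1 aaN; rewrite !set_cellE (negPf aaN) (gtn_eqF a1).
    by rewrite (gtn_eqF (ltnW a1)) s2.
apply: (halts_seq (P := eq (set_cell s 0 k0 (Posz b)))).
  by apply: halts_write (evaln_cell sN sI) e0 _ _.
move=> _ <-; apply: (halts_seq (P := eq (set_cell (set_cell s 0 k0 (Posz b)) 1 k0 (Posz b)))).
  by apply: step => //; rewrite set_cellE !eqxx.
move=> _ <-; apply: halts_weaken (step aN _ _ _) => //.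
by rewrite !set_cellE !eqxx.
Qed.

Definition counted_upto (i : nat) (s : store) : Prop :=
  [/\ regs s rN = Posz n /\ regs s rL = Posz (n * n),
      forall x y : 'I_n, arrs s 2 (x * n + y) = Posz (codeg G x y),
      forall x y : 'I_n, arrs s aN (x * n + y) = Posz (y \in nbhd G x),
      forall x y : 'I_n, x * n + y < i -> arrs s aP (x * n + y) = Posz (codeg G x y)
    & forall x : 'I_n, arrs s aB x =
        Posz #|[set y in far_nbhd G x | x * n + y < i]|].

Lemma ltn_cell (x y u v : 'I_n) :
  (x * n + y < (u * n + v).+1) = (x * n + y < u * n + v) || ((x == u) && (y == v)).
Proof.
rewrite ltnS leq_eqVlt orbC; congr (_ || _); apply/eqP/andP => [E|[/eqP-> /eqP->]] //.
have xu : x = u by apply: val_inj; rewrite /= -(cell_div x y) E cell_div.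
by rewrite xu in E *; split=> //; apply/eqP/val_inj/(addnI E).
Qed.

Lemma bad_body_spec (u v : 'I_n) s :
  counted_upto (u * n + v) s -> regs s rI = Posz (u * n + v) ->
  halts_within W bad_body s 100 (fun s' =>
    counted_upto (u * n + v).+1 s' /\ regs s' rI = Posz (u * n + v)).
Proof.
move=> [[sN sL] s2 sA sP sB] sI; set k0 := u * n + v in sP sB sI *.
have hW := cells_le_word; have cW := codeg_le u v.
have countS x : #|[set y in far_nbhd G x | x * n + y < k0.+1]| =
    #|[set y in far_nbhd G x | x * n + y < k0]| + ((x == u) && (v \in far_nbhd G u)).
  have [->|xu] := eqVneq x u; last first.
    by rewrite addn0; apply: eq_card => y; rewrite !inE ltn_cell (negPf xu) orbF.
  rewrite (cardsD1 v) addnC inE ltn_cell !eqxx orbT andbT; congr (_ + _).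
  apply: eq_card => y; rewrite !inE ltn_cell eqxx /=.
  by case: (eqVneq y v) => [->|_]; rewrite ?ltnn ?andbF // orbF.
have dW : #|[set y in far_nbhd G u | u * n + y < k0]| <= n.
  by rewrite -[X in _ <= X]card_ord max_card.
have eB : evaln W s (Bin Add (Read aB cell_row) (Bin Mul (Read aN cell) (is_far 2)))
    #|[set y in far_nbhd G u | u * n + y < k0.+1]|.
  rewrite countS eqxx in_far_nbhd /= -mulnb.
  apply: evaln_add; first by apply: evaln_read (evaln_row sN sI) (sB u) _; lia.
    apply: evaln_mul (evaln_far sN sI s2) _; last by case: (_ \in _); case: far => /=; lia.
    by apply: evaln_read (evaln_cell sN sI) (sA u v) _; case: (_ \in _) => /=; lia.
  by move: dW; set d := #|_|; case: (v \in _); case: (far G u v) => /=; lia.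
apply: (@halts_weaken _ _ _ (10 + 90) _ (fun s' => s' = set_cell
  (set_cell s aP k0 (Posz (codeg G u v))) aB u
  (Posz #|[set y in far_nbhd G u | u * n + y < k0.+1]|))) => //.
  move=> _ ->; split=> //; split=> //.
  - by move=> x y; rewrite !set_cellE !neq_arrsE /= s2.
  - by move=> x y; rewrite !set_cellE !neq_arrsE /= sA.
  - move=> x y; rewrite !set_cellE !neq_arrsE eqxx /= ltn_cell.
    case: (x * n + y =P k0) => [E _|NE]; last first.
      by rewrite orbC => /orP[/andP[/eqP xu /eqP yv]|/sP //]; rewrite xu yv in NE.
    have : x * n + y < k0.+1 by rewrite E.
    by rewrite ltn_cell E ltnn => /andP[/eqP -> /eqP ->].
  - move=> x; rewrite !set_cellE !neq_arrsE eqxx /= val_eqE sB.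
    by case: eqVneq => [->|/negPf xu] //; rewrite countS xu addn0.
apply: (halts_seq (P := eq (set_cell s aP k0 (Posz (codeg G u v))))).
  by apply: halts_write (evaln_cell sN sI) (evaln_read (evaln_cell sN sI) (s2 u v) _) _ _ => //; lia.
move=> _ <-.
have e1 : evaln W (set_cell s aP k0 (Posz (codeg G u v))) cell_row u.
  exact: (@evaln_row (set_cell _ _ _ _) u v sN sI).
apply: (halts_write e1 _ _ erefl) => //.
(* [eB] refers to the store before the write to [aP], an array that the expression does not read. *)
move: eB; apply: etrans; rewrite /is_far /degrees /degree /common /cell_row /cell_col /cell.
by rewrite /= /upd !neq_arrsE.
Qed.

Definition named_upto (i : nat) (s : store) : Prop :=
  [/\ regs s rN = Posz n /\ regs s rL = Posz (n * n),
      forall x y : 'I_n, arrs s aP (x * n + y) = Posz (codeg G x y),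
      forall x : 'I_n, arrs s aB x = Posz (bad G x)
    & forall x y : 'I_n, x * n + y < i -> joined G x y ->
        exists z : 'I_n, [/\ arrs s 2 y = Posz z, joined G z y & x <= z]].

Lemma name_body_spec (u v : 'I_n) s :
  named_upto (u * n + v) s -> regs s rI = Posz (u * n + v) ->
  halts_within W name_body s 200 (fun s' =>
    named_upto (u * n + v).+1 s' /\ regs s' rI = Posz (u * n + v)).
Proof.
move=> [[sN sL] sP sB s2] sI.
have [k ek kE] := evaln_joined sN sI sP sB.
apply: (@halts_weaken _ _ _ ((expr_cost (is_joined aP)).+1 + 20) _ _ _ _ (fun _ h => h)) => //.
apply: halts_if ek _; rewrite -[X in if X then _ else _]/(k != 0) kE.
case: ifP => uv; last first.
  apply: halts_skip => //; split=> //; split=> // x y; rewrite ltn_cell.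
  by case/orP=> [/s2 //|/andP[/eqP-> /eqP->]]; rewrite uv.
apply: halts_write (evaln_col sN sI) (evaln_row sN sI) _ _ => //.
split=> //; split=> //.
- by move=> x y; rewrite set_cellE !neq_arrsE /= sP.
- by move=> x; rewrite set_cellE !neq_arrsE /= sB.
- move=> x y; rewrite ltn_cell set_cellE eqxx /= => lt_xy xy.
  case: (nat_of_ord y =P nat_of_ord v) lt_xy => [/val_inj yv|yv].
    (* Row-major order visits column [v] by increasing row, so [u] is at least every earlier [x]
       joined to [v]. *)
    rewrite yv in xy * => lt_xv; exists u; split=> //.
    case/orP: lt_xv => [|/andP[/eqP -> //]]; rewrite ltn_add2r ltn_mul2r.
    by case/andP=> _ /ltnW.
  case/orP=> [/s2 /(_ xy) //|/andP[_ /eqP E]]; by rewrite E in yv.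
Qed.

(** Every vertex is joined to itself and hence gets named; its final name is the largest member of
    its class, which determines the class. *)
Lemma named_all s : named_upto (n * n) s ->
  forall u v : 'I_n, (arrs s 2 u == arrs s 2 v) = joined G u v.
Proof.
move=> [_ _ _ s2].
have max (v : 'I_n) : exists z : 'I_n, [/\ arrs s 2 v = Posz z, joined G z v &
    forall u : 'I_n, joined G u v -> u <= z].
  have [z [zE zv _]] := s2 v v (cell_ltn v v) (joined_refl G v).
  exists z; split=> // u uv; have [z' [z'E _ uz']] := s2 u v (cell_ltn u v) uv.
  by move: z'E; rewrite zE => -[->].
move=> u v; have [x [-> xu xM]] := max u; have [y [-> yv yM]] := max v.
apply/eqP/idP => [[/val_inj E]|uv].
  by rewrite E in xu; apply: joined_trans yv; rewrite joinedC.
congr Posz; apply/eqP; rewrite eqn_leq yM ?xM //.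
  by apply: joined_trans yv _; rewrite joinedC.
exact: joined_trans xu uv.
Qed.

Lemma mx_array_out (A : 'M[int]_n) k : n * n <= k -> mx_array A k = 0%R.
Proof.
move=> nk; rewrite /mx_array; have [n0|n0] := posnP n.
  by rewrite insubF // n0.
by rewrite insubF // ltnNge leq_divRL // nk.
Qed.

Lemma mx_array0 k : mx_array (0 : 'M[int]_n)%R k = 0%R.
Proof. by rewrite /mx_array; do 2!case: insub => [?|] //; rewrite mxE. Qed.

(** The run of [M] from [init_store] is transplanted by [exec_agree] into the store left by the
    first loop; [F] separates the names of [M] from those of the caller, whose data therefore
    survive. *)
Lemma cc_program_spec M F Tn : cmd_names M <= F -> 2 < F -> F <= rN -> F <= aN ->
  halts_within W M (init_store closed_matrix closed_matrix) Tn (fun s =>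
    forall i j : 'I_n, arrs s 2 (i * n + j) = (closed_matrix *m closed_matrix)%R i j) ->
  halts_within W (cc_program M) (cc_store G) (Tn + (424 * (n * n) + 38))
    (fun s => forall u v : 'I_n, (arrs s 2 u == arrs s 2 v) = joined G u v).
Proof.
move=> MF F2 FrN FaN runM; have hW := cells_le_word; have nW : n * n < W by lia.
(* The loops cost 108, 108 and 208 per cell plus 6 each; with 20 for the prelude this makes 424 per
   cell and 38. *)
pose for_cost tb := 2 + (n * n * (tb + 8) + 4).
apply: (@halts_weaken _ _ _ (20 + (for_cost 100 +
  (Tn + (for_cost 100 + for_cost 200)))) _ _ _ _ (fun _ h => h)); first by rewrite /for_cost; lia.
apply: (halts_seq (P := closed_upto 0)).
  pose s1 := set_reg (cc_store G) rN (Posz n).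
  apply: (@halts_seq _ _ _ _ 10 10 (eq s1)).
    by apply: (halts_assign (evaln_reg (k := n) _ _)) => //; lia.
  move=> _ <-; have en : evaln W s1 (Reg rN) n.
    by apply: evaln_reg; [rewrite set_regE eqxx|lia].
  apply: (halts_assign (evaln_mul en en _)) => //; first lia.
  split=> //.
  - by rewrite !set_regE !neq_regsE !eqxx.
  - by move=> x xN; rewrite !set_regE !ltn_eqF //; lia.
  - move=> a k; rewrite ltn0 => /orP[]/eqP-> /=; rewrite /upd ?neq_arrsE //=.
    exact: mx_array0.
  - by move=> a k a1 aaN; rewrite /= /upd (gtn_eqF a1) (gtn_eqF (ltnW a1)).
move=> s1 I1; apply: (halts_seq (P := closed_upto (n * n))).
  apply: (halts_for_all_cells nW _ _ close_body_spec I1).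
  - by move=> i s [[]].
  - move=> i s k [[sN sL] h1 h2 h3 h4]; split=> //.
      by rewrite !set_regE !neq_regsE.
    by move=> x xN; rewrite set_regE ltn_eqF ?h1 //; lia.
move=> {I1}s1 [[sN sL] sR s0 sA s2]; have [k [r [E kt Er]]] := runM.
(* Agreement is needed at every index, also from [n * n] on, where [mx_array] is zero. *)
have [|r' [E' A1 A2]] := exec_agree E MF (r := s1).
  split=> [x xM|a aM i] /=; first by rewrite sR // (leq_trans xM FrN).
  have aaN : a < aN by apply: leq_trans FaN.
  rewrite /upd; case: (a =P 1) => [->|a1].
    by rewrite sA //; case: ltnP => // ni; rewrite mx_array_out.
  case: (a =P 0) => [->|a0]; last by rewrite s2 ?ltn_eqF //; lia.
  by rewrite s0; case: ltnP => // ni; rewrite !mx_array_out.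
apply: (halts_seq (P := counted_upto 0)).
  exists k, r'; split=> //; case: A1 A2 => _ A1 [R2 A2]; split=> //.
  - by rewrite -!R2 //; lia.
  - by move=> x y; rewrite -closed_matrix_mul -Er A1.
  - by move=> x y; rewrite -A2 // sA ?eqxx ?orbT // cell_ltn mx_arrayE mxE.
  - move=> x; rewrite -A2; last lia.
    rewrite s2 ?neq_arrsE //; last lia.
    by rewrite eq_card0 // => y; rewrite inE ltn0 andbF.
move=> {s1 sN sL sR s0 sA s2 r' E' A1 A2} s1 I1.
apply: (halts_seq (P := counted_upto (n * n))).
  apply: (halts_for_all_cells nW _ _ bad_body_spec I1).
  - by move=> i s [[]].
  - move=> i s j [[sN sL] h1 h2 h3 h4]; split=> //.
    by rewrite !set_regE !neq_regsE.
move=> {I1}s1 [sNL s2 sA sP sB].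
have I1 : named_upto 0 s1.
  split=> // [x y|x]; first by rewrite sP // cell_ltn.
  rewrite sB; congr (Posz _); apply: eq_card => y.
  by rewrite inE cell_ltn andbT.
apply: (halts_weaken (leqnn _) named_all).
apply: (halts_for_all_cells nW _ _ name_body_spec I1).
- by move=> i s [[]].
- move=> i s j [[sN sL] h1 h2 h3]; split=> //.
  by rewrite !set_regE !neq_regsE.
Qed.

End Program.

(** * Choice of names, word size and running time *)

Lemma multiplies_cells M T n : multiplies_matrices M T -> (n * n <= T n)%N.
Proof.
move=> /(_ 0%N) [k MT].
(* The square of the all-ones matrix has every entry equal to [n], so each of the n^2 initially zero
   cells of array 2 must be written. *)
have [||t [s [E tT sP]]] := MT n (const_mx 1) (const_mx 1); try by move=> i j; rewrite mxE.
apply: leq_trans tT; apply: leq_trans (exec_changed_cells 2 (n * n) E).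
rewrite -[X in (X <= _)%N]card_ord -sum1_card; apply: leq_sum => i _.
have n0 : (0 < n)%N by case: n i {MT s sP E} => // -[].
have un : (i %/ n < n)%N by rewrite ltn_divLR.
have vn : (i %% n < n)%N by rewrite ltn_mod.
have := sP (Ordinal un) (Ordinal vn); rewrite /= -divn_eq => ->.
rewrite /init_store /= /upd /= !mxE lt0b.
under eq_bigr do rewrite !mxE mulr1.
by rewrite sumr_const card_ord eq_sym pnatr_eq0 -lt0n.
Qed.
(** [F] is above every name in [M] and at least 3, as names 0 to 2 serve input and output. Registers
    and arrays are separate and may share numbers. *)
Definition cc_algorithm (M : cmd) : cmd :=
  let F := maxn 3 (cmd_names M) in cc_program F F.+1 F.+2 F F.+1 F.+2 M.

Lemma cc_algorithm_spec M T : multiplies_matrices M T ->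
  exists k : nat, forall (n : nat) (G : instance 'I_n),
    halts_within ((n + 2) ^ k) (cc_algorithm M) (cc_store G)
      (T n + (424 * (n * n) + 38))
      (fun s => forall u v : 'I_n, (arrs s 2 u == arrs s 2 v) = joined G u v).
Proof.
(* Degree 0 suffices for 0-1 entries; the 9 makes room for the caller, as 64 (n + 2)^2 <= 2^7 (n +
   2)^2 <= (n + 2)^9. *)
move=> /(_ 0%N) [k MT]; exists (k + 9)%N => n G.
have kW : ((n + 2) ^ k <= (n + 2) ^ (k + 9))%N.
  by rewrite leq_exp2l ?leq_addr // addn2.
have W_large : (64 * (n + 2) ^ 2 <= (n + 2) ^ (k + 9))%N.
  apply: (@leq_trans ((n + 2) ^ 9)); last by rewrite leq_exp2l ?leq_addl // addn2.
  rewrite (expnD _ 7 2) leq_mul2r; apply/orP; right.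
  by apply: (@leq_trans (2 ^ 7)) => //; rewrite leq_exp2r // leq_addl.
apply: (@cc_program_spec _ _ _ _ _ _ _ n G W_large _ _ M (maxn 3 (cmd_names M))); try lia.
have [||t [s [E tT sP]]] := MT n (closed_matrix G) (closed_matrix G).
- by move=> i j; rewrite mxE; case: (_ \in _).
- by move=> i j; rewrite mxE; case: (_ \in _).
- by exists t, s; split=> //; apply: exec_le kW E.
Qed.

(** Multiplication enters as a subroutine [M] of arbitrary time [T], which expresses the bound
    n^omega without fixing omega. *)
Theorem theorem1 (R : realType) :
  exists (c : R) (Alg : cmd -> cmd),
    1 <= c /\
    forall (M : cmd) (T : nat -> nat),
      multiplies_matrices M T ->
      exists (t : nat -> nat) (k : nat),
        ((fun n : nat => (t n)%:R : R^o) =O_\oo (fun n : nat => (T n)%:R : R^o))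
        /\
        forall (n : nat) (G : instance 'I_n),
          halts_within ((n + 2) ^ k) (Alg M) (cc_store G) (t n)
            (fun s =>
               clustering (cc_output n s) /\
               forall p : \bar R, (1 <= p)%E ->
                 cc_cost G p (cc_output n s) <= c * OPT G p).
Proof.
exists 384, cc_algorithm; split; first by rewrite ler1n.
move=> M T MT; have [k kP] := cc_algorithm_spec MT.
exists (fun n => T n + (424 * (n * n) + 38))%N, k; split.
  (* 463 = 1 + 424 + 38, using [n * n <= T n] and, for the additive constant, that [n] is
     positive. *)
  apply/eqO_exP; exists 463; first by rewrite ltr0n.
  near=> n; rewrite !normr_nat -natrM ler_nat.
  have n0 : (0 < n)%N by near: n; exists 1%N.
  have := multiplies_cells n MT; nia.
move=> n G; apply: halts_weaken (leqnn _) _ (kP n G) => s sP; split.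
  exact: preim_partitionP.
by move=> p p1; apply: cc_cost_le_OPT.
Unshelve. all: by end_near. Qed.
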